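(* Let $G=(V,E)$ and the algorithm be as described in the context, with $n=|V|$. Under the distributed fair daemon, every execution starting from an arbitrary configuration reaches a stable configuration after at most $2n+1$ rounds.
   Context: Let $G=(V,E)$ be a finite simple undirected graph; each node is a process and $N(i)$ denotes the set of neighbours of $i$. Each process has an identifier from a totally ordered set; identifiers of any two distinct processes at distance at most $2$ are distinct, and comparisons such as $j>i$ between processes are comparisons of their identifiers. Each process $i$ holds variables $m_i\in\{\text{true},\text{false}\}$ and $p_i\in\{null\}\cup N(i)$; a configuration is an assignment of values to all these variables. Define the predicate $PRmarried(i)\equiv \exists j\in N(i): (p_i=j \text{ and } p_j=i)$. The algorithm consists of the following four guarded rules for each process $i$ (a rule is enabled at $i$ if its guard holds; at most one rule is enabled at a process at any time): Update: if $m_i\neq PRmarried(i)$ then $m_i:=PRmarried(i)$. Marriage: if $m_i=PRmarried(i)$ and $p_i=null$ and there is $j\in N(i)$ with $p_j=i$, then $p_i:=j$ (for such a $j$). Seduction: if $m_i=PRmarried(i)$ and $p_i=null$ and $p_k\neq i$ for all $k\in N(i)$ and there is $j\in N(i)$ with $p_j=null$, $j>i$ and $m_j=\text{false}$, then $p_i:=\max\{j\in N(i): p_j=null,\ j>i,\ m_j=\text{false}\}$. Abandonment: if $m_i=PRmarried(i)$ and $p_i=j\neq null$ and $p_j\neq i$ and ($m_j=\text{true}$ or $j\le i$), then $p_i:=null$. A process is eligible if some rule is enabled at it; a configuration is stable if no process is eligible. A step from a configuration $C$ consists of a nonempty subset of the processes eligible in $C$ each executing its enabled rule, all guards and assignments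 being evaluated in $C$; an execution is a maximal sequence of configurations, starting from an arbitrary configuration, each obtained from the previous one by a step. The execution of a rule by a process is a move. The distributed fair daemon additionally requires that every process which is continuously eligible eventually makes a move. A round is a smallest segment of an execution in which every process that was eligible at the beginning of the segment either makes a move or becomes ineligible during the segment; an execution is split into consecutive rounds. *)

(* Defs.v *)
From mathcomp Require Import all_boot all_order.

Set Implicit Arguments.
Unset Strict Implicit.
Unset Printing Implicit Defensive.

Definition dist_le (V : finType) (e : rel V) (k : nat) (i j : V) : Prop :=
  exists s : seq V, [/\ path e i s, last i s = j & size s <= k].

(* [p_ C i = None] encodes p_i = null; [p_nbr] says p_i \in {null} \cup N(i). *)
Record config (V : finType) (e : rel V) := Config {
  m_ : V -> bool;
  p_ : V -> option V;
  p_nbr : forall i j, p_ i = Some j -> e i j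
}.

Inductive rule := Update | Marriage | Seduction | Abandonment.

Section Algorithm.
Variables (V : finType) (e : rel V).
Variables (d : Order.disp_t) (I : orderType d) (ident : V -> I).

Implicit Types (C : config e) (i j : V).

Definition PRmarried C i : bool :=
  [exists j, [&& e i j, p_ C i == Some j & p_ C j == Some i]].

Definition seducible C i j : bool :=
  [&& e i j, p_ C j == None, (ident i < ident j)%O & ~~ m_ C j].

Definition guard C i (r : rule) : bool :=
  match r with
  | Update => m_ C i != PRmarried C i
  | Marriage =>
      [&& m_ C i == PRmarried C i, p_ C i == None
        & [exists j, e i j && (p_ C j == Some i)]]
  | Seduction =>
      [&& m_ C i == PRmarried C i, p_ C i == None,
          [forall k, e i k ==> (p_ C k != Some i)]
        & [exists j, seducible C i j]]
  | Abandonment =>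
      (m_ C i == PRmarried C i) &&
      (if p_ C i is Some j
       then (p_ C j != Some i) && (m_ C j || (ident j <= ident i)%O)
       else false)
  end.

(* Effect of the assignment of [r] on the variables of [i], from [C] to [C'].
   It is a relation because Marriage may choose any neighbour pointing to i. *)
Definition effect C i (r : rule) C' : Prop :=
  match r with
  | Update => m_ C' i = PRmarried C i /\ p_ C' i = p_ C i
  | Marriage =>
      m_ C' i = m_ C i /\
      exists j, [/\ e i j, p_ C j = Some i & p_ C' i = Some j]
  | Seduction =>
      m_ C' i = m_ C i /\
      exists j, [/\ seducible C i j,
                    forall k, seducible C i k -> (ident k <= ident j)%O
                  & p_ C' i = Some j]
  | Abandonment => m_ C' i = m_ C i /\ p_ C' i = None
  end.

Definition eligible C i : Prop := exists r, guard C i r.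

Definition stable C : Prop := forall i, ~ eligible C i.

Definition step C (S : {set V}) C' : Prop :=
  [/\ S != set0,
      forall i, i \in S -> exists r, guard C i r /\ effect C i r C'
    & forall i, i \notin S -> m_ C' i = m_ C i /\ p_ C' i = p_ C i].

(* A finite or infinite sequence of configurations: [last_idx = Some l] means
   conf 0, ..., conf l, and [None] means infinite; the values of [conf] beyond
   the last index are meaningless.  [movers t] is the set of processes making a
   move in the step from conf t to conf t.+1. *)
Record trace := Trace {
  last_idx : option nat;
  conf : nat -> config e;
  movers : nat -> {set V}
}.

Implicit Types (E : trace).

Definition in_trace E (t : nat) : bool :=
  if last_idx E is Some l then t <= l else true.

(* The second conjunct is maximality: a finite execution cannot be extended. *)
Definition execution E : Prop :=
  (forall t, in_trace E t.+1 -> step (conf E t) (movers E t) (conf E t.+1)) /\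
  (forall l, last_idx E = Some l ->
     ~ exists (S : {set V}) C', step (conf E l) S C').

Definition moves E (t : nat) i : Prop := in_trace E t.+1 /\ i \in movers E t.

Definition fair E : Prop :=
  forall i t, in_trace E t ->
    (forall u, t <= u -> in_trace E u -> eligible (conf E u) i) ->
    exists u, t <= u /\ moves E u i.

(* The segment from conf a to conf b, made of the steps a, ..., b.-1. *)
Definition covers E (a b : nat) : Prop :=
  forall i, eligible (conf E a) i ->
    (exists t, a <= t < b /\ moves E t i) \/
    (exists t, a <= t <= b /\ ~ eligible (conf E t) i).

Definition is_round E (a b : nat) : Prop :=
  [/\ a < b, in_trace E b, covers E a b
    & forall c, a < c < b -> ~ covers E a c].

(* [after_rounds E k t]: the k first rounds of E are the segment [0, t]. *)
Inductive after_rounds E : nat -> nat -> Prop :=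
| after_rounds0 : after_rounds E 0 0
| after_roundsS k a b :
    after_rounds E k a -> is_round E a b -> after_rounds E k.+1 b.

End Algorithm.

(* Main.v *)
Require Import Defs.
From mathcomp Require Import all_boot all_order zify.
From Stdlib Require Import Classical.

Set Implicit Arguments.
Unset Strict Implicit.
Unset Printing Implicit Defensive.

Import Order.TTheory.

(** Marriages are never broken, and after one round [m_i] implies that [i] is
    married, forever after.  Consider then four consecutive rounds.  If the first
    two create no marriage, every married process has raised its flag and every
    pointer of an unmarried process goes to an unmarried process with a larger
    identifier.  Such pointers are never abandoned without a new marriage.
    Unless the configuration is stable, the third round creates such a pointer if
    there was none; the highest pointing process then points to a null process,
    which has to marry in the fourth round.  So each four rounds add two married
    processes.  When nobody is married, the only pointers to be abandoned are the
    downward ones, which takes one round: the first marriage thus costs three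
    rounds instead of four, which compensates the round in which the last couple
    raises its flags. *)

Section Matching.
Variables (V : finType) (e : rel V).
Hypotheses (e_sym : symmetric e) (e_irr : irreflexive e).
Variables (d : Order.disp_t) (I : orderType d) (ident : V -> I).
Hypothesis ident_neq :
  forall i j : V, i <> j -> dist_le e 2 i j -> ident i <> ident j.

Implicit Types (C : config e) (i j : V) (S : {set V}).

(** * Marriages, pointers and guards *)

Lemma PRmarriedP C i :
  reflect (exists j, p_ C i = Some j /\ p_ C j = Some i) (PRmarried C i).
Proof.
apply: (iffP existsP) => [[j /and3P[_ /eqP pi /eqP pj]]|[j [pi pj]]].
  by exists j.
by exists j; rewrite pi pj !eqxx !andbT (p_nbr pi).
Qed.

Lemma null_unmarried C i : p_ C i = None -> ~~ PRmarried C i.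
Proof. by move=> pi; apply/PRmarriedP => -[j []]; rewrite pi. Qed.

Lemma pointer_unmarried C i j :
  p_ C i = Some j -> p_ C j != Some i -> ~~ PRmarried C i.
Proof.
by move=> pi /eqP pj; apply/PRmarriedP => -[k []]; rewrite pi => -[<-].
Qed.

Lemma unmarried_pointer C i j :
  p_ C i = Some j -> ~~ PRmarried C i -> p_ C j != Some i.
Proof. by move=> pi /PRmarriedP um; apply/eqP => pj; apply: um; exists j. Qed.

Lemma pointed_unmarried C i k :
  p_ C k = Some i -> p_ C i = None -> ~~ PRmarried C k.
Proof. by move=> pk pi; apply: (pointer_unmarried pk); rewrite pi. Qed.

Lemma edge_neq i j : e i j -> i <> j.
Proof. by move=> + ij; rewrite ij e_irr. Qed.

Lemma edge_ident_le i j : e i j -> (ident i <= ident j)%O -> (ident i < ident j)%O.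
Proof.
move=> eij le_ij; rewrite lt_neqAle le_ij andbT; apply/eqP.
by apply: ident_neq (edge_neq eij) _; exists [:: j]; rewrite /= eij.
Qed.

(** The flag, the nullity of the pointer and the presence of a suitor tell the rules apart. A
    process known to have a given rule enabled can thus execute only that one. *)
Lemma guard_inj C i r r' : guard ident C i r -> guard ident C i r' -> r = r'.
Proof.
have sedF k : e i k && (p_ C k == Some i) ->
    ~ [forall k, e i k ==> (p_ C k != Some i)].
  by move=> /andP[ek pk] /forallP/(_ k); rewrite ek pk.
case: r; case: r' => //=; case: (m_ C i == _) => //=;
  case: (p_ C i) => //= ; rewrite ?andbF //.
- by move=> /existsP[k /sedF hk] /andP[].
- by move=> /andP[al _] /existsP[k /sedF hk].
Qed.

(** * Effect of a single step *)

Section Step.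
Variables (C C' : config e) (S : {set V}).
Hypothesis CC' : step ident C S C'.

Lemma step_case i :
  (m_ C' i = m_ C i /\ p_ C' i = p_ C i) \/
  exists2 r, guard ident C i r & effect ident C i r C'.
Proof.
case: CC' => _ mv st; case: (boolP (i \in S)) => [/mv[r []]|/st]; last by left.
by right; exists r.
Qed.

Lemma step_pointer i j :
  p_ C i = Some j -> p_ C' i = Some j \/ guard ident C i Abandonment.
Proof.
move=> pi; case: (step_case i) => [[_ ->]|[[] /= gd ef]]; first by left.
- by left; rewrite ef.2.
- by move: gd; rewrite pi andbF.
- by move: gd; rewrite pi andbF.
- by right.
Qed.

(** Abandonment requires that the pointer is not returned, so neither partner of a couple can
    execute it. *)
Lemma step_married i : PRmarried C i -> PRmarried C' i.
Proof.
have keep k l : p_ C k = Some l -> p_ C l = Some k -> p_ C' k = Some l.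
  by move=> pk pl; case: (step_pointer pk) => //=; rewrite pk pl eqxx andbF.
move=> /PRmarriedP[j [pi pj]]; apply/PRmarriedP.
by exists j; split; apply: keep.
Qed.

Lemma step_unmarried i : ~~ PRmarried C' i -> ~~ PRmarried C i.
Proof. exact/contra/step_married. Qed.

(* A process that marries downwards cannot be abandoned in the same step. *)
Lemma step_new_pointer i j :
  p_ C' i = Some j -> ~~ PRmarried C' i -> p_ C i <> Some j ->
  (ident i < ident j)%O /\ ~~ PRmarried C j.
Proof.
move=> pi' um' pi; case: (step_case i) => [[_ pE]|[[] /= gd ef]].
- by rewrite -pE in pi.
- by rewrite -ef.2 in pi.
- case/and3P: gd => /eqP mi /eqP pi0 _.
  case: ef => _ [k []]; rewrite pi' => eij pj [jk]; subst k.
  split; last exact: pointed_unmarried pj pi0.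
  case: (leP (ident j) (ident i)) => // le_ji.
  case: (step_pointer pj) => [pj'|/=].
    by case/PRmarriedP: um'; exists j.
  rewrite pj pi0 mi (negbTE (null_unmarried pi0)) /= => /andP[_ le_ij].
  by have := edge_ident_le eij le_ij; rewrite ltNge le_ji.
- case: ef => _ [k []] /and4P[_ /eqP pk lt_ik _] _; rewrite pi' => -[jk].
  by subst k; split=> //; apply: null_unmarried.
- by move: pi'; rewrite ef.2.
Qed.

(** Only Update raises a flag, and only on a process married in [C], which stays married; the flag
    of an unmarried process is never fresh. *)
Lemma step_flag i : m_ C' i -> ~~ PRmarried C' i -> m_ C i.
Proof.
move=> mi' /step_unmarried um; case: (step_case i) => [[<-]|[[] /= _ []]] //.
- by rewrite mi' => /esym; rewrite (negbTE um).
- by rewrite mi' => <-.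
- by rewrite mi' => <-.
- by rewrite mi' => <-.
Qed.

Lemma step_keeps_flag i : m_ C i -> PRmarried C i -> m_ C' i.
Proof.
move=> mi mar; case: (step_case i) => [[->]|[[] /= _ []]] // -> //.
Qed.

End Step.

(** * Invariants and growth of the set of married processes *)

Definition sound C := forall i, m_ C i -> PRmarried C i.

Definition complete C := forall i, PRmarried C i -> m_ C i.

Definition ascending C :=
  forall i j, p_ C i = Some j -> ~~ PRmarried C i -> (ident i < ident j)%O.

Definition courting C :=
  forall i j, p_ C i = Some j -> ~~ PRmarried C i -> ~~ PRmarried C j.

(** Two rounds without a marriage lead from a sound configuration to this state, which then persists
    until the next marriage. *)
Definition clean C := [/\ sound C, complete C, ascending C & courting C].

Definition married C : {set V} := [set i | PRmarried C i].

Lemma card_married C : #|married C| <= #|V|.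
Proof. exact: max_card. Qed.

Lemma sound_unmarried C i : sound C -> ~~ PRmarried C i -> m_ C i = false.
Proof. by move=> sd um; apply/negP => /sd; apply/negP. Qed.

Lemma sound_unmarried_flag C i :
  sound C -> ~~ PRmarried C i -> m_ C i == PRmarried C i.
Proof. by move=> sd um; rewrite (sound_unmarried sd um) (negbTE um). Qed.

Lemma step_sound C S C' : step ident C S C' -> sound C -> sound C'.
Proof.
move=> st sd i mi'; apply: contraT => um'.
have := step_unmarried st um'.
by rewrite (sd _ (step_flag st mi' um')).
Qed.

Lemma step_married_sub C S C' :
  step ident C S C' -> married C \subset married C'.
Proof. by move=> st; apply/subsetP => i; rewrite !inE => /(step_married st). Qed.

Lemma eq_married C C' :
  married C = married C' -> forall i, PRmarried C i = PRmarried C' i.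
Proof. by move=> eM i; move/setP/(_ i): eM; rewrite !inE. Qed.

Lemma step_complete C S C' : step ident C S C' -> married C = married C' ->
  complete C -> complete C'.
Proof.
move=> st eM cp i; rewrite -(eq_married eM) => mar.
exact: step_keeps_flag st i (cp _ mar) mar.
Qed.

Lemma step_ascending C S C' : step ident C S C' -> ascending C -> ascending C'.
Proof.
move=> st up i j pi' um'; case: (p_ C i =P Some j) => [pi|pi].
  exact: up pi (step_unmarried st um').
by case: (step_new_pointer st pi' um' pi).
Qed.

Lemma step_clean C S C' : step ident C S C' -> married C = married C' ->
  clean C -> clean C'.
Proof.
move=> st eM [sd cp up co]; split; first exact: step_sound st sd.
- exact: step_complete st eM cp.
- exact: step_ascending st up.
move=> i j pi' um'; rewrite -(eq_married eM).
case: (p_ C i =P Some j) => [pi|pi].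
  exact: co pi (step_unmarried st um').
by case: (step_new_pointer st pi' um' pi).
Qed.

(** Abandonment is never enabled: an unmarried process points upwards to an unmarried target, whose
    flag is down by soundness, and a married one has its pointer returned. *)
Lemma clean_pointer_stays C S C' i j : step ident C S C' -> clean C ->
  p_ C i = Some j -> p_ C' i = Some j.
Proof.
move=> st [sd _ up co] pi; case: (step_pointer st pi) => //=.
rewrite pi => /and3P[_ pj ab]; have um := pointer_unmarried pi pj.
move: ab; rewrite (sound_unmarried sd (co _ _ pi um)) /= leNgt.
by rewrite (up _ _ pi um).
Qed.

(** Among the unmarried processes that point somewhere, take the one with the largest identifier.
    Its target is unmarried and higher, hence null. *)
Lemma clean_top_pointer C i j : clean C -> p_ C i = Some j -> ~~ PRmarried C i ->
  exists k l, p_ C k = Some l /\ p_ C l = None.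
Proof.
move=> [_ _ up co] pi um; pose P k := ~~ PRmarried C k && (p_ C k != None).
have Pi : P i by rewrite /P um pi.
case: (Order.TotalTheory.arg_maxP ident Pi) => k /andP[umk pk] kmax.
case pkE: (p_ C k) pk => [l|] // _; exists k, l; split=> //.
case plE: (p_ C l) => [h|] //.
have : (ident l <= ident k)%O by apply: kmax; rewrite /P (co _ _ pkE umk) plE.
by rewrite leNgt (up _ _ pkE umk).
Qed.

Lemma courted_guard C i j : sound C -> p_ C i = Some j -> p_ C j = None ->
  guard ident C j Marriage.
Proof.
move=> sd pi pj /=; rewrite sound_unmarried_flag ?null_unmarried // pj eqxx.
by apply/existsP; exists i; rewrite e_sym (p_nbr pi) pi eqxx.
Qed.

Lemma unmarried_abandon_guard C i j : sound C -> p_ C i = Some j ->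
  ~~ PRmarried C i -> m_ C j || (ident j <= ident i)%O ->
  guard ident C i Abandonment.
Proof.
move=> sd pi um ab /=.
by rewrite sound_unmarried_flag // pi ab (unmarried_pointer pi um).
Qed.

Lemma all_married_stable C :
  sound C -> complete C -> married C = setT -> stable ident C.
Proof.
move=> sd cp /setP allM i [r]; have mar : PRmarried C i.
  by have := allM i; rewrite !inE.
have /PRmarriedP[j [pi pj]] := mar.
by case: r; rewrite /= mar cp //= pi //= pj eqxx.
Qed.

(** The partner [j] of a newly married [i] is new as well: had [j] been married before, its kept
    pointer would show that [i] was its partner already. *)
Lemma married_growth C C' : married C \subset married C' ->
  (forall i j, p_ C i = Some j -> p_ C j = Some i -> p_ C' i = Some j) ->
  married C <> married C' -> #|married C| + 2 <= #|married C'|.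
Proof.
move=> sub keep neM.
have : married C \proper married C' by rewrite properEneq sub andbT; apply/eqP.
case/properP => _ [i]; rewrite !inE => /PRmarriedP[j [pi' pj']] umi.
have umj : ~~ PRmarried C j.
  apply/PRmarriedP => -[k [pj pk]]; have := keep _ _ pj pk.
  rewrite pj' => -[ik]; subst k; case/PRmarriedP: umi; by exists j.
have ij : i != j by apply/eqP/edge_neq/(p_nbr pi').
have <- : #|married C :|: [set i; j]| = #|married C| + 2.
  rewrite cardsU cards2 ij.
  suff -> : married C :&: [set i; j] = set0 by rewrite cards0 subn0.
  apply/setP => k; rewrite !inE; apply/negbTE/negP => /andP[mk].
  by case/orP=> /eqP kE; move: mk; rewrite kE; apply/negP.
apply/subset_leq_card/subsetP => k; rewrite !inE => /orP[mk|].
  by have /subsetP/(_ k) := sub; rewrite !inE; apply.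
by case/orP=> /eqP ->; apply/PRmarriedP; [exists j | exists i].
Qed.

(** * Induction along the segments of an execution *)

Section Run.
Variable E : trace e.
Hypotheses (E_exec : execution ident E) (E_fair : fair ident E).

Lemma in_trace_leq t u : t <= u -> in_trace E u -> in_trace E t.
Proof. by rewrite /in_trace; case: last_idx => // l; apply: leq_trans. Qed.

Lemma trace_step b t : in_trace E b -> t < b ->
  step ident (conf E t) (movers E t) (conf E t.+1).
Proof. by move=> inb tb; apply: E_exec.1; apply: in_trace_leq inb. Qed.

Lemma segment_ind (P : config e -> Prop) a b : in_trace E b ->
  (forall t, a <= t < b -> P (conf E t) -> P (conf E t.+1)) ->
  P (conf E a) -> forall t, a <= t <= b -> P (conf E t).
Proof.
move=> inb stepP Pa; elim=> [|t IH] /andP[le_a le_b].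
  by move: le_a Pa; rewrite leqn0 => /eqP ->.
move: le_a; rewrite leq_eqVlt => /orP[/eqP <- //|lt_a].
by apply: stepP; [lia | apply: IH; lia].
Qed.

(** Forward induction on the negation of [P]. It spreads a defect found at the end of a round over
    the whole round, so that a rule correcting it must be executed. *)
Lemma segment_rev_ind (P : config e -> Prop) a b : in_trace E b ->
  (forall t, a <= t < b -> P (conf E t.+1) -> P (conf E t)) ->
  P (conf E b) -> forall t, a <= t <= b -> P (conf E t).
Proof.
move=> inb stepP Pb t /andP[le_a le_b]; apply: NNPP => nPt.
have : ~ P (conf E b).
  apply: (@segment_ind (fun C => ~ P C) t b) => // [u ub nPu /stepP Pu|].
    by apply: nPu; apply: Pu; lia.
  by rewrite le_b leqnn.
exact.
Qed.

Lemma segment_married_sub a b : in_trace E b -> a <= b ->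
  married (conf E a) \subset married (conf E b).
Proof.
move=> inb ab.
apply: (@segment_ind (fun C => married (conf E a) \subset married C) a b) => //.
  move=> t /andP[_ tb] /subset_trans; apply.
  exact/step_married_sub/(trace_step inb).
by rewrite ab leqnn.
Qed.

Lemma segment_sound a b : in_trace E b -> sound (conf E a) ->
  forall t, a <= t <= b -> sound (conf E t).
Proof.
move=> inb; apply: (segment_ind inb) => t /andP[_ tb].
exact/step_sound/(trace_step inb).
Qed.

Lemma segment_growth a b : in_trace E b -> a <= b ->
  married (conf E a) <> married (conf E b) ->
  #|married (conf E a)| + 2 <= #|married (conf E b)|.
Proof.
move=> inb ab; apply: married_growth (segment_married_sub inb ab) _ => i j pi pj.
suff /(_ b) [|//] : forall t, a <= t <= b ->
    p_ (conf E t) i = Some j /\ p_ (conf E t) j = Some i.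
  by rewrite ab leqnn.
apply: (@segment_ind (fun C => p_ C i = Some j /\ p_ C j = Some i)) => //.
move=> t /andP[_ tb] [qi qj]; have st := trace_step inb tb.
split; [case: (step_pointer st qi)|case: (step_pointer st qj)] => //=.
  by rewrite qi qj eqxx andbF.
by rewrite qj qi eqxx andbF.
Qed.

(** * Segments without a new marriage *)

Section ConstantSegment.
Variables a b : nat.
Hypothesis inb : in_trace E b.
Hypothesis eM : married (conf E a) = married (conf E b).

Lemma constant_married t : a <= t <= b -> married (conf E t) = married (conf E b).
Proof.
move=> /andP[le_a le_b]; apply/eqP; rewrite eqEsubset segment_married_sub //=.
by rewrite -eM segment_married_sub //; apply: in_trace_leq inb.
Qed.

Lemma constant_married_step t : a <= t < b ->
  married (conf E t) = married (conf E t.+1).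
Proof. by move=> tb; rewrite !constant_married //; lia. Qed.

Lemma constant_PRmarried t i : a <= t <= b ->
  PRmarried (conf E t) i = PRmarried (conf E b) i.
Proof. by move=> tb; apply/eq_married/constant_married. Qed.

Lemma segment_complete : complete (conf E a) ->
  forall t, a <= t <= b -> complete (conf E t).
Proof.
apply: (segment_ind inb) => t tb; apply: step_complete (constant_married_step tb).
by apply: trace_step inb _; lia.
Qed.

Lemma segment_clean : clean (conf E a) ->
  forall t, a <= t <= b -> clean (conf E t).
Proof.
apply: (segment_ind inb) => t tb; apply: step_clean (constant_married_step tb).
by apply: trace_step inb _; lia.
Qed.

Lemma segment_clean_pointer t u i j : clean (conf E a) -> a <= t <= u -> u <= b ->
  p_ (conf E t) i = Some j -> p_ (conf E u) i = Some j.
Proof.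
move=> cl /andP[le_a le_tu] ub pi.
apply: (@segment_ind (fun C => p_ C i = Some j) t b) => // [v vb|]; last lia.
apply: clean_pointer_stays (trace_step inb _) _; first lia.
by apply: segment_clean => //; lia.
Qed.

End ConstantSegment.

(** * Forced moves, existence of rounds, and soundness after a round *)

(** A guard that holds throughout keeps [i] eligible, so being covered means moving, and no rule
    other than [r] is available. *)
Lemma covered_move a b i r : in_trace E b -> a <= b -> covers ident E a b ->
  (forall t, a <= t <= b -> guard ident (conf E t) i r) ->
  exists2 t, a <= t < b & effect ident (conf E t) i r (conf E t.+1).
Proof.
move=> inb ab cov gd.
case: (cov i) => [|[t [tb [_ mv]]]|[t [tb ne]]].
- by exists r; apply: gd; rewrite leqnn.
- have st : step ident (conf E t) (movers E t) (conf E t.+1).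
    by apply: trace_step inb _; lia.
  case: st => _ /(_ _ mv)[r' [gd' ef]] _; exists t => //.
  by rewrite (@guard_inj _ _ r r' _ gd') //; apply: gd; lia.
- by case: ne; exists r; apply: gd.
Qed.

(** Fairness bounds the time by which each process is covered; the maximum over the finite set [V]
    covers all, and the least covering endpoint ends the round. *)
Lemma round_exists a : in_trace E a -> ~ stable ident (conf E a) ->
  exists b, is_round ident E a b.
Proof.
move=> ina /not_all_not_ex[i0 el0].
have each i : exists b, [/\ a <= b, in_trace E b &
    eligible ident (conf E a) i ->
    (exists t, a <= t < b /\ moves E t i) \/
    (exists t, a <= t <= b /\ ~ eligible ident (conf E t) i)].
  case: (classic (exists u, [/\ a <= u, in_trace E u &
                              ~ eligible ident (conf E u) i])).
    move=> [u [au inu ne]]; exists u; split=> // _; right; exists u.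
    by rewrite au leqnn.
  move=> allel; case: (E_fair (i := i) ina) => [u au inu|u [au mv]].
    by apply: NNPP => ne; apply: allel; exists u.
  exists u.+1; split; [by lia | by case: mv | move=> _; left; exists u].
  by rewrite au ltnSn.
have [b0 [ab0 inb0 cov0]] : exists b, [/\ a <= b, in_trace E b & covers ident E a b].
  suff [b [ab inb cov]] : exists b, [/\ a <= b, in_trace E b &
      forall i, i \in enum V -> eligible ident (conf E a) i ->
      (exists t, a <= t < b /\ moves E t i) \/
      (exists t, a <= t <= b /\ ~ eligible ident (conf E t) i)].
    by exists b; split=> // i; apply: cov; rewrite mem_enum.
  elim: (enum V) => [|i s [b [ab inb cov]]]; first by exists a.
  have [b' [ab' inb' cov']] := each i.
  exists (maxn b b'); split; first by lia.
    by rewrite /maxn; case: ifP.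
  move=> k; rewrite inE => /orP[/eqP ->|ks] el.
    by case: (cov' el) => -[t [tb h]]; [left | right]; exists t; split=> //; lia.
  by case: (cov k ks el) => -[t [tb h]]; [left | right]; exists t; split=> //; lia.
have [n [le_n [an cov] min]] : exists n, [/\ n <= b0, a <= n /\ covers ident E a n
    & forall c, a <= c < n -> ~ covers ident E a c].
  elim/ltn_ind: b0 ab0 cov0 {inb0} => b IH ab cov.
  case: (classic (exists c, a <= c < b /\ covers ident E a c)).
    case=> c [/andP[ac cb] covc]; have [n [nc h min]] := IH c cb ac covc.
    by exists n; split=> //; lia.
  by move=> none; exists b; split=> // c cb covc; apply: none; exists c.
exists n; split; [|exact: in_trace_leq inb0|done|by move=> c cn; apply: min; lia].
(* The process [i0], eligible at [a], is not covered by the empty segment. *)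
rewrite ltn_neqAle an andbT; apply/eqP => na; subst n.
case: (cov i0 el0) => -[t [tb h]]; first by lia.
by have ta : t = a by [lia]; subst t.
Qed.

Lemma after_rounds_in_trace r a : after_rounds ident E r a -> in_trace E a.
Proof.
by case=> [|? ? ? _ [] //]; rewrite /in_trace; case: last_idx.
Qed.

Lemma next_round r a : after_rounds ident E r a -> stable ident (conf E a) \/
  exists b, [/\ a <= b, in_trace E b, covers ident E a b
              & after_rounds ident E r.+1 b].
Proof.
move=> ar; case: (classic (stable ident (conf E a))) => [|nst]; first by left.
have [b rd] := round_exists (after_rounds_in_trace ar) nst.
right; exists b; have [/ltnW ab inb cov _] := rd; split=> //.
exact: after_roundsS ar rd.
Qed.

(** A raised flag on a process unmarried at [b] would have been there throughout, forcing an Update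
    that lowers it. Marriages may occur in this round. *)
Lemma round_sound a b : in_trace E b -> a <= b -> covers ident E a b ->
  sound (conf E b).
Proof.
move=> inb ab cov i mi; apply: contraT => um.
have all : forall t, a <= t <= b ->
    m_ (conf E t) i /\ ~~ PRmarried (conf E t) i.
  apply: (@segment_rev_ind (fun C => m_ C i /\ ~~ PRmarried C i)) => // t tb.
  have st : step ident (conf E t) (movers E t) (conf E t.+1).
    by apply: trace_step inb _; lia.
  by move=> [mi' um']; rewrite (step_flag st mi' um') (step_unmarried st um').
have [t|t tb /= [mt _]] := @covered_move a b i Update inb ab cov.
  by case/all => /= -> /negbTE ->.
have [|mt' _] := all t.+1; first by lia.
have [|_ /negbTE ut] := all t; first by lia.
by rewrite mt ut in mt'.
Qed.

(** * Rounds without a new marriage *)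

Section Round.
Variables a b : nat.
Hypotheses (inb : in_trace E b) (ab : a <= b) (cov : covers ident E a b).
Hypothesis eM : married (conf E a) = married (conf E b).
Hypothesis sd : sound (conf E a).

Lemma round_complete : complete (conf E b).
Proof.
move=> i mar; apply: NNPP => /negP/negbTE mi.
have all : forall t, a <= t <= b -> ~~ m_ (conf E t) i.
  apply: (@segment_rev_ind (fun C => ~~ m_ C i)); rewrite ?mi // => t tb.
  apply: contra => mt; apply: step_keeps_flag (trace_step inb _) _ mt _; first lia.
  by rewrite (constant_PRmarried inb eM) //; lia.
have [t tb|t tb /= [mt _]] := @covered_move a b i Update inb ab cov.
  by rewrite /= (constant_PRmarried inb eM _ tb) mar (negbTE (all t tb)).
have /negP[] := all t.+1 ltac:(lia).
by rewrite mt (constant_PRmarried inb eM) //; lia.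
Qed.

(** Abandonment would be enabled throughout, and its forced execution would make the pointer null
    within the round. *)
Lemma round_abandon i j : p_ (conf E b) i = Some j ->
  ~~ PRmarried (conf E b) i ->
  (forall t, a <= t <= b -> m_ (conf E t) j || (ident j <= ident i)%O) ->
  ~ (forall t, a <= t <= b -> p_ (conf E t) i = Some j).
Proof.
move=> pi um ab_ok all.
have [t tb|t tb /= [_]] := @covered_move a b i Abandonment inb ab cov.
  apply: unmarried_abandon_guard (segment_sound inb sd tb) (all t tb) _ (ab_ok t tb).
  by rewrite (constant_PRmarried inb eM).
by rewrite all //; lia.
Qed.

(** By [step_new_pointer], a pointer acquired during the segment goes upwards to an unmarried
    target; any other is as old as the segment. *)
Lemma segment_old_pointer i j : ~~ PRmarried (conf E b) i ->
  p_ (conf E b) i = Some j ->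
  ~ ((ident i < ident j)%O /\ ~~ PRmarried (conf E b) j) ->
  forall t, a <= t <= b -> p_ (conf E t) i = Some j.
Proof.
move=> um pi new.
apply: (@segment_rev_ind (fun C => p_ C i = Some j)) => // t tb pi'.
apply: NNPP => pt; apply: new.
rewrite -(constant_PRmarried inb eM j (t := t)); last by lia.
have st : step ident (conf E t) (movers E t) (conf E t.+1).
  by apply: trace_step inb _; lia.
apply: (step_new_pointer st pi' _ pt).
by rewrite (constant_PRmarried inb eM) //; lia.
Qed.

Lemma round_ascending : ascending (conf E b).
Proof.
move=> i j pi um; case: (leP (ident j) (ident i)) => // le_ji.
exfalso; apply: (round_abandon pi um) => [t _|]; first by rewrite le_ji orbT.
by apply: segment_old_pointer => // -[]; rewrite ltNge le_ji.
Qed.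

(** An upward pointer to a married target can be abandoned only once the target has raised its flag;
    hence [complete] at [a], which costs an earlier round. *)
Lemma round_courting : complete (conf E a) -> courting (conf E b).
Proof.
move=> cp i j pi um; apply/negP => mar.
apply: (round_abandon pi um) => [t tb|].
  rewrite (segment_complete inb eM cp tb) //.
  by rewrite (constant_PRmarried inb eM).
by apply: segment_old_pointer => // -[]; rewrite mar.
Qed.

Lemma round_sound_keep : sound (conf E b).
Proof. by apply: segment_sound inb sd _ _; rewrite ab leqnn. Qed.

(** If no unmarried process points anywhere during the round, the rule enabled at [a] can only be
    Seduction; it stays enabled, and its execution creates a pointer. *)
Lemma clean_round_pointer : clean (conf E a) -> ~ stable ident (conf E a) ->
  exists i j, p_ (conf E b) i = Some j /\ p_ (conf E b) j = None.
Proof.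
move=> cl /not_all_not_ex[i [r gd]]; apply: NNPP => none.
(* A pointer of an unmarried process would survive until [b], where [clean_top_pointer] yields a
   pointer to a null process. *)
have nopt : forall t k l, a <= t <= b -> p_ (conf E t) k = Some l ->
    PRmarried (conf E t) k.
  move=> t k l tb pk; rewrite (constant_PRmarried inb eM) //.
  apply: contraT => umk; case: none.
  apply: (@clean_top_pointer _ k l) umk.
    by apply: (segment_clean inb eM cl); lia.
  by apply: (segment_clean_pointer inb eM (t := t)) => //; lia.
have in_a : a <= a <= b by rewrite leqnn.
case: (cl) => _ cp _ _; case: r gd => /=.
- move=> /eqP; case; case mar: (PRmarried _ i); first by rewrite cp.
  by rewrite sound_unmarried ?mar.
- move=> /and3P[_ /eqP pi /existsP[k /andP[_ /eqP pk]]].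
  by have := nopt a k i in_a pk; rewrite (negbTE (pointed_unmarried pk pi)).
- move=> /and4P[_ /eqP pi _ /existsP[j /and4P[eij /eqP pj lt_ij _]]].
  (* By [nopt] a pointer at [t] would mean that [l] is married, but it is unmarried at [a] and no
     marriage occurs. *)
  have null t l : a <= t <= b -> p_ (conf E a) l = None -> p_ (conf E t) l = None.
    move=> tb pl; case plE: (p_ (conf E t) l) => [h|] //.
    have := nopt t l h tb plE; rewrite (constant_PRmarried inb eM) //.
    by rewrite -(constant_PRmarried inb eM l in_a) (negbTE (null_unmarried pl)).
  have [t tb|t tb /= [_ [h [_ _]]]] := @covered_move a b i Seduction inb ab cov.
    have sdt := segment_sound inb sd tb.
    have pit := null t i tb pi; have pjt := null t j tb pj.
    rewrite /= sound_unmarried_flag ?null_unmarried // pit eqxx /=.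
    apply/andP; split.
      apply/forallP => k; apply/implyP => _; apply/eqP => pk.
      by have := nopt t k i tb pk; rewrite (negbTE (pointed_unmarried pk pit)).
    apply/existsP; exists j; rewrite /seducible eij pjt lt_ij.
    by rewrite sound_unmarried ?null_unmarried.
  by rewrite null //; lia.
- case pi: (p_ _ i) => [j|] /andP[_ //] /andP[pj _].
  by have := nopt a i j in_a pi; rewrite (negbTE (pointer_unmarried pi pj)).
Qed.

(** The pointer of [i] stays, so Marriage remains enabled at [j] as long as [j] is null. The forced
    move would add a marriage. *)
Lemma clean_round_marries i j : clean (conf E a) ->
  p_ (conf E a) i = Some j -> p_ (conf E a) j = None -> False.
Proof.
move=> cl pi pj.
have all_i : forall t, a <= t <= b -> p_ (conf E t) i = Some j.
  by move=> t tb; apply: (segment_clean_pointer inb eM cl _ _ pi); lia.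
have all_j : forall t, a <= t <= b -> p_ (conf E t) j = None.
  apply: (@segment_ind (fun C => p_ C j = None)) => // t tb pjt.
  have st : step ident (conf E t) (movers E t) (conf E t.+1).
    by apply: trace_step inb _; lia.
  have pit : p_ (conf E t) i = Some j by apply: all_i; lia.
  case: (step_case st j) => [[_ ->] //|[r gd]].
  have sdt : sound (conf E t) by apply: segment_sound inb sd _ _; lia.
  (* The chosen [k] may differ from [i], but its pointer to [j] stays too, so the move would marry
     [j]. *)
  rewrite -(guard_inj (courted_guard sdt pit pjt) gd) /= => -[_ [k [_ pk pj']]].
  have clt : clean (conf E t) by apply: (segment_clean inb eM cl); lia.
  have pk' := clean_pointer_stays st clt pk.
  have /PRmarriedP[] : ~~ PRmarried (conf E t.+1) j; last by exists k.
  rewrite (constant_PRmarried inb eM); last by lia.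
  by rewrite -(constant_PRmarried inb eM (t := t)) ?null_unmarried //; lia.
have [t tb|t tb /= [_ [k [_ _]]]] := @covered_move a b j Marriage inb ab cov.
  apply: (@courted_guard _ i); first exact: segment_sound inb sd _ tb.
    exact: all_i.
  exact: all_j.
by rewrite all_j //; lia.
Qed.

End Round.

(** * Counting the rounds *)

(** Here [r] counts rounds from the start of the execution, while the growth is measured from
    [a]. *)
Definition marries r a :=
  exists2 t, after_rounds ident E r t & sound (conf E t) /\
    #|married (conf E a)| + 2 <= #|married (conf E t)|.

Definition stabilizes r :=
  exists k t : nat, [/\ k <= r, after_rounds ident E k t & stable ident (conf E t)].

Lemma stabilizes_leq r r' : r <= r' -> stabilizes r -> stabilizes r'.
Proof.
by move=> le_r [k [t [le_k art st]]]; exists k, t; split=> //; lia.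
Qed.

Lemma sound_round r a : after_rounds ident E r a -> sound (conf E a) ->
  [\/ stable ident (conf E a), marries r.+1 a |
    exists b, [/\ after_rounds ident E r.+1 b, in_trace E b, a <= b,
      covers ident E a b & married (conf E a) = married (conf E b)]].
Proof.
move=> ar sd; case: (next_round ar) => [|[b [ab inb cov ar']]].
  by constructor 1.
case: (classic (married (conf E a) = married (conf E b))) => [eM|neM].
  by constructor 3; exists b.
constructor 2; exists b => //; split; last exact: segment_growth.
by apply: segment_sound inb sd _ _; rewrite ab leqnn.
Qed.

Lemma clean_phase r a : after_rounds ident E r a -> clean (conf E a) ->
  stable ident (conf E a) \/ exists2 r', r' <= r + 2 & marries r' a.
Proof.
move=> ar cl; case: (cl) => sd _ _ _.
case: (classic (stable ident (conf E a))) => [|nst]; first by left.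
right; case: (sound_round ar sd) => // [mar|[b [ar1 inb ab cov eM]]].
  by exists r.+1 => //; lia.
have clb : clean (conf E b) by apply: (segment_clean inb eM cl); rewrite ab leqnn.
have [i [j [pi pj]]] := clean_round_pointer inb ab cov eM sd cl nst.
case: (clb) => sdb _ _ _; case: (sound_round ar1 sdb) => [st|mar|].
- by case: (st j); exists Marriage; apply: courted_guard pi pj.
- by exists r.+2; [lia | case: mar => t art [sdt gr]; exists t; rewrite ?eM].
- case=> c [ar2 inc bc cov' eM'].
  by case: (clean_round_marries inc bc cov' eM' sdb clb pi pj).
Qed.

(** The first round raises the flags and removes downward pointers, the second removes pointers to
    married processes; [clean_phase] adds two more. *)
Lemma sound_phase r a : after_rounds ident E r a -> sound (conf E a) ->
  stabilizes (r + 2) \/ exists2 r', r' <= r + 4 & marries r' a.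
Proof.
move=> ar sd; case: (sound_round ar sd) => [st|mar|].
- by left; exists r, a; split=> //; lia.
- by right; exists r.+1 => //; lia.
move=> [b [ar1 inb ab cov eM]].
have sdb := round_sound_keep inb ab sd.
have cpb := round_complete inb ab cov eM.
have upb := round_ascending inb ab cov eM sd.
case: (sound_round ar1 sdb) => [st|mar|].
- by left; exists r.+1, b; split=> //; lia.
- by right; exists r.+2; [lia | rewrite /marries eM].
move=> [c [ar2 inc bc cov' eM']].
have clc : clean (conf E c).
  split; first exact: round_sound_keep inc bc sdb.
  - exact: round_complete inc bc cov' eM'.
  - exact: round_ascending inc bc cov' eM' sdb.
  - exact: round_courting inc bc cov' eM' sdb cpb.
case: (clean_phase ar2 clc) => [st|[r' le_r' mar]].
  by left; exists r.+2, c; split=> //; lia.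
by right; exists r'; [lia | rewrite /marries eM eM'].
Qed.

Lemma first_phase r a : after_rounds ident E r a -> sound (conf E a) ->
  married (conf E a) = set0 ->
  stabilizes (r + 1) \/ exists2 r', r' <= r + 3 & marries r' a.
Proof.
move=> ar sd M0; case: (sound_round ar sd) => [st|mar|].
- by left; exists r, a; split=> //; lia.
- by right; exists r.+1 => //; lia.
move=> [b [ar1 inb ab cov eM]].
have clb : clean (conf E b).
  split; first exact: round_sound_keep inb ab sd.
  - exact: round_complete inb ab cov eM.
  - exact: round_ascending inb ab cov eM sd.
  (* Nobody is married, so [courting] takes no round of its own. *)
  - move=> i j _ _; have /setP/(_ j) : married (conf E b) = set0 by rewrite -eM.
    by rewrite !inE => ->.
case: (clean_phase ar1 clb) => [st|[r' le_r' mar]].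
  by left; exists r.+1, b; split=> //; lia.
by right; exists r'; [lia | rewrite /marries eM].
Qed.

(** Each unmarried process pays for two rounds, so the two processes married in a phase pay for its
    four rounds. The final 1 is the round in which the last flags are raised. *)
Lemma sound_stabilizes r a : after_rounds ident E r a -> sound (conf E a) ->
  stabilizes (r + 2 * (#|V| - #|married (conf E a)|) + 1).
Proof.
move cE: (#|V| - _) => c; elim/ltn_ind: c r a cE => c IH r a cE ar sd.
case: (posnP c) => [c0|c_gt0].
  case: (sound_round ar sd) => [st|[t _ [_ gr]]|].
  - by exists r, a; split=> //; lia.
  - by have := card_married (conf E t); lia.
  move=> [b [ar1 inb ab cov eM]]; exists r.+1, b; split=> //; first lia.
  apply: all_married_stable; first exact: round_sound_keep inb ab sd.
    exact: round_complete inb ab cov eM.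
  apply/eqP; rewrite -eM eqEcard subsetT cardsT; lia.
case: (sound_phase ar sd) => [|[r' le_r' [t art [sdt gr]]]].
  by apply: stabilizes_leq; lia.
have leM := card_married (conf E t).
by apply: stabilizes_leq (IH _ _ r' t erefl art sdt); lia.
Qed.

Lemma stabilizes_2n1 : stabilizes (2 * #|V| + 1).
Proof.
case: (next_round (after_rounds0 ident E)) => [st|[b [ab inb cov ar]]].
  by exists 0, 0; split=> //; constructor.
have sdb := round_sound inb ab cov.
(* With no process the bound is 1, below the 2 rounds that [first_phase] may give. *)
case: (posnP #|V|) => [V0|V_gt0].
  exists 0, 0; split=> //; first by constructor.
  by move=> i; have := card0_eq V0 i.
case: (posnP #|married (conf E b)|) => [/cards0_eq M0|M_gt0]; last first.
  (* The initial round is offset by the processes already married, each of which saves two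
     rounds. *)
  by apply: stabilizes_leq (sound_stabilizes ar sdb);
    have := card_married (conf E b); lia.
case: (first_phase ar sdb M0) => [|[r' le_r' [t art [sdt gr]]]].
  by apply: stabilizes_leq; lia.
(* The initial round and three more give at least two married processes:
   [4 + 2 * (n - 2) + 1 = 2 * n + 1]. *)
by apply: stabilizes_leq (sound_stabilizes art sdt);
  have := card_married (conf E t); lia.
Qed.

End Run.
End Matching.

Theorem theorem3 (V : finType) (e : rel V)
  (e_sym : symmetric e) (e_irr : irreflexive e)
  (d : Order.disp_t) (I : orderType d) (ident : V -> I)
  (ident_neq : forall i j : V, i <> j -> dist_le e 2 i j -> ident i <> ident j)
  (E : trace e) (E_exec : execution ident E) (E_fair : fair ident E) :
  exists k t : nat,
    [/\ k <= 2 * #|V| + 1, after_rounds ident E k t & stable ident (conf E t)].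
Proof. exact: stabilizes_2n1. Qed.
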